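(* $M(6,5)<30$. That is, every set $\Gamma$ of permutations of $\{1,\dots,6\}$ in which any two distinct elements $\phi,\psi$ satisfy $d_H(\phi,\psi)\ge 5$ has fewer than $30$ elements.
   Context: For permutations $\phi,\psi\in\mathrm{Sym}(n)$, the Hamming distance $d_H(\phi,\psi)$ is the number of non-fixed points of $\phi\psi^{-1}$, equivalently the number of $x\in\{1,\dots,n\}$ with $\phi(x)\ne\psi(x)$. $M(n,d)$ denotes the maximum size of a subset $\Gamma\subseteq\mathrm{Sym}(n)$ such that $d_H(\phi,\psi)\ge d$ for all distinct $\phi,\psi\in\Gamma$. *)

(* Defs.v *)
From HB Require Import structures.
From mathcomp Require Import all_boot all_fingroup.

Set Implicit Arguments.
Unset Strict Implicit.
Unset Printing Implicit Defensive.

(* MathComp composes permutations from left to right, (s * t) x = t (s x), so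
   the composite x |-> phi (psi^-1 x) is written psi^-1 * phi. *)
Definition dH (n : nat) (phi psi : 'S_n) : nat :=
  #|[set x : 'I_n | (psi^-1 * phi)%g x != x]|.

Definition perm_code (n d : nat) (Gamma : {set 'S_n}) : bool :=
  [forall phi in Gamma, forall psi in Gamma,
     (phi != psi) ==> (d <= dH phi psi)].

Definition M (n d : nat) : nat :=
  \max_(Gamma : {set 'S_n} | perm_code d Gamma) #|Gamma|.

Lemma dHE (n : nat) (phi psi : 'S_n) :
  dH phi psi = #|[set x : 'I_n | phi x != psi x]|.
Proof.
rewrite /dH -[RHS](card_imset _ (@perm_inj _ psi)).
apply: eq_card => y; rewrite inE permM; apply/idP/imsetP => [h | [x]].
  by exists ((psi^-1)%g y); rewrite ?inE permKV.
by rewrite inE => h ->; rewrite permK.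
Qed.

Lemma perm_codeP (n d : nat) (Gamma : {set 'S_n}) :
  reflect {in Gamma &, forall phi psi, phi <> psi -> d <= dH phi psi}
          (perm_code d Gamma).
Proof.
apply: (iffP forall_inP) => [h phi psi phiG psiG /eqP neq | h phi phiG].
  by move/forall_inP: (h _ phiG) => /(_ _ psiG) /implyP; apply.
by apply/forall_inP=> psi psiG; apply/implyP=> /eqP; apply: h.
Qed.

Lemma ltn_MP (n d k : nat) :
  reflect (forall Gamma : {set 'S_n}, perm_code d Gamma -> #|Gamma| < k.+1)
          (M n d < k.+1).
Proof. by rewrite ltnS; apply: (iffP (bigmax_leqP _ _ _)). Qed.

(* Main.v *)
Require Import Defs.
From mathcomp Require Import all_boot all_fingroup.
From mathcomp Require Import all_order all_algebra ring zify.

(** A code of 30 permutations together with the 6 constant functions is a set of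
    36 functions any two of which agree in at most one point; their graphs and
    the vertical lines form an affine plane of order 6, whose projective closure
    is excluded by the Bruck-Ryser argument: over the rationals it would yield a
    solution of [6 x^2 = 1 + w^2], impossible modulo 3. *)

Set Implicit Arguments.
Unset Strict Implicit.
Unset Printing Implicit Defensive.

Import Order.TTheory GRing.Theory Num.Theory.

(** * Counting over finite types *)

Lemma imset_inj_full (aT rT : finType) (f : aT -> rT) (A : {set aT}) :
  {in A &, injective f} -> #|rT| <= #|A| -> f @: A = [set: rT].
Proof.
by move=> inj le; apply/eqP; rewrite eqEcard subsetT cardsT card_in_imset.
Qed.

Lemma card_option_pred (T : finType) (P : pred (option T)) :
  #|P| = P None + #|[pred x | P (Some x)]|.
Proof.
have Some_injT : injective (@Some T) by move=> x y [].
rewrite (cardD1 None) unfold_in; congr (_ + _).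
rewrite -(card_image Some_injT); apply: eq_card => -[x|].
  by rewrite mem_image ?inE.
by rewrite !inE; apply/esym/negbTE/imageP => -[].
Qed.

Lemma card_sum_pred (A B : finType) (P : pred (A + B)) :
  #|P| = #|[pred x | P (inl x)]| + #|[pred x | P (inr x)]|.
Proof. by rewrite -!sum1_card big_sumType. Qed.

(** * From a large family of functions to an affine plane and its projective closure *)

Section AffinePlane.

Context {T : finType} (G : {set {ffun T -> T}}).
Hypothesis G_card : #|T| ^ 2 <= #|G|.
Hypothesis G_eq : forall f g x y, f \in G -> g \in G ->
  x != y -> f x = g x -> f y = g y -> f = g.

(** By [G_eq], evaluation at [x] and [x'] is injective from [G] to pairs; by [G_card] it is then a
    bijection. *)
Lemma card_through2 (x x' y y' : T) : x != x' ->
  #|[set f in G | (f x == y) && (f x' == y')]| = 1.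
Proof.
move=> nx; pose ev (f : {ffun T -> T}) := (f x, f x').
have ev_inj : {in G &, injective ev} by move=> f g fG gG []; apply: G_eq.
have: (y, y') \in ev @: G.
  by rewrite imset_inj_full // card_prod mulnn.
case/imsetP => f fG [-> ->]; apply/eqP/cards1P; exists f.
apply/setP => g; rewrite !inE; apply/andP/eqP => [[gG /andP[/eqP e /eqP e']]|-> //].
  by apply: (@G_eq _ _ _ _ _ _ nx).
by rewrite !eqxx.
Qed.

Lemma exists_through2 (x x' y y' : T) : x != x' ->
  exists2 f, f \in G & f x = y /\ f x' = y'.
Proof.
move=> nx; have /eqP/cards1P[f E] := card_through2 y y' nx.
have: f \in [set f] by rewrite inE.
by rewrite -E inE => /andP[fG /andP[/eqP <- /eqP <-]]; exists f.
Qed.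

Context {o e : T} (oe : o != e).

Lemma exists_neq (x : T) : exists x', x != x'.
Proof. by case: (eqVneq x o) => [->|]; [exists e | exists o]. Qed.

Lemma card_through (x y : T) : #|[set f in G | f x == y]| = #|T|.
Proof.
have [x' nx] := exists_neq x.
have inj : {in [set f in G | f x == y] &, injective (fun f : {ffun T -> T} => f x')}.
  move=> f g; rewrite !inE => /andP[fG /eqP fx] /andP[gG /eqP gx].
  by apply: (@G_eq _ _ _ _ _ _ nx) => //; rewrite fx.
rewrite -(card_in_imset inj) -cardsT; congr #|pred_of_set _|; apply/setP => z.
rewrite inE; have [f fG [fx fx']] := exists_through2 y z nx.
by apply/imsetP; exists f; rewrite ?inE ?fG ?fx /=.
Qed.

Definition parallel (f g : {ffun T -> T}) : bool :=
  (f == g) || [forall x, f x != g x].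

Lemma parallelxx f : parallel f f.
Proof. by rewrite /parallel eqxx. Qed.

Lemma parallel_sym f g : parallel f g = parallel g f.
Proof.
by rewrite /parallel eq_sym; congr (_ || _); apply: eq_forallb => x; rewrite eq_sym.
Qed.

Lemma parallel_meet f g x : parallel f g -> f x = g x -> f = g.
Proof. by case/orP => [/eqP //|/forallP/(_ x)/eqP]. Qed.

(* The lines through (x, y) meeting f are in bijection with the points of f off
   the column x, so exactly one of the #|T| lines through (x, y) misses f. *)
Lemma card_parallel_through f (x y : T) : f \in G ->
  #|[set g in G | parallel f g && (g x == y)]| = 1.
Proof.
move=> fG; case: (eqVneq (f x) y) => [fxy|fxy].
  apply/eqP/cards1P; exists f; apply/setP => g; rewrite !inE.
  apply/and3P/eqP => [[_ p /eqP gx]|->]; last by rewrite parallelxx fxy.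
  by symmetry; apply: (@parallel_meet f g x p); rewrite fxy gx.
pose N := [set g in G | ~~ parallel f g && (g x == y)].
(* The default [x] is harmless: [meet] is only used for [g] not parallel to [f], where [pick]
   succeeds. *)
pose meet (g : {ffun T -> T}) := odflt x [pick t | f t == g t].
have meetP g : ~~ parallel f g -> f (meet g) = g (meet g).
  rewrite /parallel /meet => /norP[_ /forallPn[t]]; rewrite negbK => ft.
  by case: pickP => [u /eqP //|/(_ t)]; rewrite ft.
have meet_inj : {in N &, injective meet}.
  move=> g h; rewrite !inE => /and3P[gG pg /eqP gx] /and3P[hG ph /eqP hx] E.
  apply: (@G_eq g h x (meet g) gG hG); rewrite ?gx ?hx //.
    by apply: contraNneq fxy => E'; rewrite {1}E' meetP // -E' gx.
  by rewrite -meetP // E meetP.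
have meetN : meet @: N = [set~ x].
  apply/setP => t; rewrite !inE; apply/imsetP/idP => [[g]|tx].
    rewrite inE => /and3P[gG pg /eqP gx] ->.
    by apply: contraNneq fxy => E'; rewrite -{1}E' meetP // E' gx.
  have [g gG [gt gx]] := exists_through2 (f t) y tx.
  have pg : ~~ parallel f g.
    apply: contraNN fxy => p.
    by rewrite (parallel_meet p (esym gt)) gx.
  exists g; first by rewrite inE gG pg gx eqxx.
  apply/eqP; apply: contraNT fxy => nt.
  rewrite (_ : f = g) ?gx //; apply: (@G_eq f g t (meet g) fG gG) => //.
  exact: meetP.
have cardN : #|N| = #|T|.-1 by rewrite -(card_in_imset meet_inj) meetN cardsC1.
have := cardsID [set g | parallel f g] [set g in G | g x == y].
rewrite card_through.
have -> : [set g in G | g x == y] :\: [set g | parallel f g] = N.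
  by apply/setP => g; rewrite !inE; do !case: (_ \in _); case: parallel.
have -> : [set g in G | g x == y] :&: [set g | parallel f g] =
          [set g in G | parallel f g && (g x == y)].
  by apply/setP => g; rewrite !inE andbAC -!andbA.
have : 0 < #|T| by apply/card_gt0P; exists x.
rewrite cardN; case: #|T| => // n _ /eqP.
by rewrite -add1n eqn_add2r => /eqP.
Qed.

Lemma parallel_through f (x y : T) : f \in G ->
  exists g, [/\ g \in G, parallel f g & g x = y].
Proof.
move=> fG; have /eqP/cards1P[g E] := card_parallel_through x y fG.
have: g \in [set g] by rewrite inE.
by rewrite -E inE => /and3P[gG p /eqP <-]; exists g.
Qed.

(** Playfair's axiom: it makes parallelism transitive on [G], so that slopes label parallel
    classes. *)
Lemma parallel_through_eq f g h (x : T) : f \in G -> g \in G -> h \in G ->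
  parallel f g -> parallel f h -> g x = h x -> g = h.
Proof.
move=> fG gG hG pg ph E; have /eqP/cards1P[k K] := card_parallel_through x (g x) fG.
have: g \in [set k] by rewrite -K inE gG pg eqxx.
have: h \in [set k] by rewrite -K inE hG ph E eqxx.
by rewrite !inE => /eqP -> /eqP.
Qed.

(** A parallel class is labelled by the value at [e] of its unique member through the origin ([o],
    [o]). For [f] in [G] this member exists, so the default is never taken. *)
Definition slope (f : {ffun T -> T}) : T :=
  odflt o (omap (fun g : {ffun T -> T} => g e)
    [pick g in G | parallel f g && (g o == o)]).

Lemma slopeE f r : f \in G -> r \in G -> r o = o -> (slope f == r e) = parallel r f.
Proof.
move=> fG rG ro; rewrite /slope; case: pickP => [g /and3P[gG p /eqP go] | none] /=.
  apply/eqP/idP => [ge|p'].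
    rewrite parallel_sym (_ : r = g) //.
    by apply: (@G_eq _ _ _ _ _ _ oe); rewrite ?ro.
  by rewrite (@parallel_through_eq f g r o) ?ro // parallel_sym.
have [g [gG p go]] := parallel_through o o fG.
by have := none g; rewrite gG p go eqxx.
Qed.

Lemma card_slope_through (m x y : T) :
  #|[set f in G | (slope f == m) && (f x == y)]| = 1.
Proof.
have [r rG [ro re]] := exists_through2 o m oe.
rewrite -(card_parallel_through x y rG); apply: eq_card => f; rewrite !inE.
by case: (boolP (f \in G)) => // fG; rewrite -re slopeE.
Qed.

Lemma card_slope (m : T) : #|[set f in G | slope f == m]| = #|T|.
Proof.
rewrite -sum1dep_card (partition_big (fun f : {ffun T -> T} => f o) predT) //=.
rewrite -sum1_card; apply: eq_bigr => y _; rewrite sum1dep_card.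
rewrite -[RHS](card_slope_through m o y); apply: eq_card => f.
by rewrite !inE andbA.
Qed.

(* The projective closure: inr (Some m) is the point at infinity of slope m and
   inr None that of the vertical lines; inr (Some x) is the vertical line over x
   and inr None the line at infinity. *)
Definition incident (l : {f | f \in G} + option T) (p : T * T + option T) : bool :=
  match l, p with
  | inl f, inl (x, y) => val f x == y
  | inl f, inr (Some m) => slope (val f) == m
  | inl _, inr None => false
  | inr (Some x0), inl (x, _) => x == x0
  | inr (Some _), inr (Some _) => false
  | inr (Some _), inr None => true
  | inr None, inl _ => false
  | inr None, inr _ => true
  end.

(** These are the entries of the Gram matrix of the incidence matrix. Each pair of kinds of points
    reduces to one of the counts above, the added 1 often being the vertical line or the line at
    infinity. *)
Lemma card_incident2 p q :
  #|[set l | incident l p && incident l q]| = (p == q) * #|T| + 1.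
Proof.
have sub (P : pred {ffun T -> T}) :
  #|[pred f : {f | f \in G} | P (val f)]| = #|[set f in G | P f]|.
  rewrite -!sum1_card [RHS](reindex_omap (val : {f | f \in G} -> _) insub) /=.
    by apply: eq_bigl => f; rewrite !inE valK eqxx (valP f) andbT.
  by move=> f; rewrite inE => /andP[fG _]; rewrite insubT.
have c0 (X : finType) : #|[pred x : X | false]| = 0 by apply: eq_card0.
have c1 (x : T) (b : bool) : #|[pred z | (x == z) && b]| = b.
  case: b; last by apply: eq_card0 => z; rewrite inE andbF.
  by rewrite /= -(card1 x); apply: eq_card => z; rewrite !inE andbT eq_sym.
have Some_injT : injective (@Some T) by move=> ? ? [].
have inlE (u v : T * T) : (inl u == inl v :> T * T + option T) = (u == v) by [].
have inrE (u v : option T) : (inr u == inr v :> T * T + option T) = (u == v) by [].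
rewrite cardsE card_sum_pred card_option_pred /=.
case: p q => [[x y]|[m|]] [[x' y']|[m'|]] /=.
- rewrite (sub (fun f => (f x == y) && (f x' == y'))).
  have -> : #|[pred z | (x == z) && (x' == z)]| = (x == x').
    by rewrite -(c1 x); apply: eq_card => z; rewrite !inE; case: eqP => // ->; rewrite eq_sym.
  have [<-|nx] := eqVneq x x'; last first.
    by rewrite card_through2 // inlE xpair_eqE /= (negPf nx).
  have [<-|ny] := eqVneq y y'.
    rewrite inlE xpair_eqE /= !eqxx mul1n -(card_through x y); congr (_ + _).
    by apply: eq_card => f; rewrite !inE andbb.
  rewrite inlE xpair_eqE /= eqxx (negPf ny) [X in X + _]eq_card0 //= => f; rewrite !inE.
  by apply/negP => /and3P[_ /eqP -> /eqP E]; rewrite E eqxx in ny.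
- rewrite (sub (fun f => (f x == y) && (slope f == m'))).
  rewrite c1 /= !addn0 -(card_slope_through m' x y).
  by apply: eq_card => f; rewrite !inE; congr (_ && _); rewrite andbC.
- rewrite c1 addnC; congr (_ + _).
  by apply: eq_card0 => f; rewrite !inE andbF.
- rewrite (sub (fun f => (slope f == m) && (f x' == y'))).
  by rewrite c0 card_slope_through.
- rewrite (sub (fun f => (slope f == m) && (slope f == m'))) c0.
  have [<-|nm] := eqVneq m m'.
    rewrite eqxx mul1n.
    by rewrite -(card_slope m); congr (_ + _); apply: eq_card => f; rewrite !inE andbb.
  rewrite inrE (inj_eq Some_injT) (negPf nm) [X in X + _]eq_card0 //= => f; rewrite !inE.
  by apply/negP => /and3P[_ /eqP -> /eqP E]; rewrite E eqxx in nm.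
- by rewrite c0 [X in X + _]eq_card0 // => f; rewrite !inE andbF.
- by rewrite c0 add0n -(card1 x'); apply: eq_card => z; rewrite !inE eq_sym.
- by rewrite !c0.
- by rewrite c0 add0n mul1n addnC.
Qed.

Lemma card_functions : #|G| = #|T| ^ 2.
Proof.
apply/eqP; rewrite eqn_leq G_card andbT.
pose ev (f : {ffun T -> T}) := (f o, f e).
have ev_inj : {in G &, injective ev}.
  by move=> f g fG gG []; apply: (@G_eq _ _ _ _ _ _ oe).
by rewrite -(card_in_imset ev_inj) (leq_trans (max_card _)) // card_prod mulnn.
Qed.

Lemma card_projective_lines :
  #|{: {f | f \in G} + option T}| = #|{: T * T + option T}|.
Proof. by rewrite !card_sum card_sig card_functions card_prod mulnn. Qed.

End AffinePlane.

(** * The obstruction modulo 3 *)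

(** Infinite descent: squares are 0 or 1 modulo 3, so 3 divides [a] and [b]; then 9 divides
    [6 * c ^ 2], so 3 divides [c], and all three can be divided by 3. *)
Lemma sum_two_squares_neq_6square (a b c : nat) :
  a ^ 2 + b ^ 2 = 6 * c ^ 2 -> a = 0.
Proof.
elim/ltn_ind: c a b => c IH a b E.
have mod3 (k : nat) : exists q r, k = 3 * q + r /\ r < 3.
  by exists (k %/ 3), (k %% 3); rewrite ltn_mod mulnC -divn_eq.
have [p [r [Ea r3]]] := mod3 a; have [q [s [Eb s3]]] := mod3 b.
have [t [u [Ec u3]]] := mod3 c.
have [r0 s0] : r = 0 /\ s = 0.
  rewrite -!mulnn Ea Eb in E.
  by move: r3 s3 E; case: r {Ea} => [|[|[|]]] //; case: s {Eb} => [|[|[|]]] //;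
     move=> _ _ E; lia.
subst r s; rewrite !addn0 in Ea Eb.
have u0 : u = 0.
  rewrite -!mulnn Ea Eb Ec in E.
  by move: u3 E; case: u {Ec} => [|[|[|]]] // _ E; lia.
subst u; rewrite addn0 in Ec; subst a b c.
case: (posnP t) => [t0|t_gt0]; first by subst t; move: E; rewrite -!mulnn; nia.
have -> // := IH t _ p q; first by lia.
by move: E; rewrite -!mulnn; nia.
Qed.

(** * The Bruck-Ryser argument over a field *)

Section LinearAlgebra.

Local Open Scope ring_scope.

Lemma rat_neq_6square (x w : rat) : 6 * x ^+ 2 != 1 + w ^+ 2.
Proof.
apply/eqP => E.
have [dx dw] : (denq x)%:~R != 0 :> rat /\ (denq w)%:~R != 0 :> rat.
  by rewrite !intr_eq0 !denq_neq0.
(* Multiplying by the square of both denominators makes the term 1 a nonzero square, against the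
   descent. *)
have Ez : (6 * (numq x * denq w) ^+ 2 =
           (denq x * denq w) ^+ 2 + (numq w * denq x) ^+ 2)%R.
  apply: (@intr_inj rat); rewrite !(rmorphD, rmorphM, rmorphXn) /=.
  move: E; rewrite -{1}(divq_num_den x) -{1}(divq_num_den w) => E.
  move: E dx dw.
  move: (numq x)%:~R (numq w)%:~R (denq x)%:~R (denq w)%:~R => a b c d E c0 d0.
  have: 6 * (a / c) ^+ 2 * (c * d) ^+ 2 = (1 + (b / d) ^+ 2) * (c * d) ^+ 2.
    by rewrite E.
  have -> : 6 * (a / c) ^+ 2 * (c * d) ^+ 2 = 6 * (a * d) ^+ 2 by field.
  by move=> ->; field.
have : (`|(denq x * denq w)%R| = 0)%N.
  apply: (@sum_two_squares_neq_6square _ `|(numq w * denq x)%R| `|(numq x * denq w)%R|).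
  by apply/eqP; rewrite -eqz_nat PoszD PoszM -!abszX !abszE !normrX !real_normK ?num_real // Ez.
by move/eqP; rewrite absz_eq0 mulf_eq0 !denq_eq0.
Qed.

(** The determinant is affine in the first sign, with slope minus a minor that is nonzero by
    induction. If it vanished at both 1 and -1, twice that minor would be 0. *)
Lemma exists_sign_det_neq0 (F : fieldType) (n : nat) (A : 'M[F]_n) :
  2 != 0 :> F ->
  exists2 s : 'rV[F]_n, forall i, s 0 i ^+ 2 = 1 & \det (A - diag_mx s) != 0.
Proof.
move=> two_neq0; elim: n A => [|n IH] A.
  by exists 0; [case | rewrite det_mx00 oner_eq0].
have [s s2 D_neq0] := IH (row' 0 (col' 0 A)).
pose S e := row_mx (e%:M : 'rV_1) s : 'rV[F]_n.+1.
have S2 e : e ^+ 2 = 1 -> forall i, S e 0 i ^+ 2 = 1.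
  move=> e2 i; rewrite /S mxE; case: splitP => j _ //.
  by rewrite ord1 mxE eqxx.
have S0 e : S e 0 0 = e.
  by rewrite /S mxE; case: splitP => j // _; rewrite ord1 mxE eqxx.
have Sl e j : S e 0 (lift 0 j) = s 0 j.
  by rewrite /S mxE; case: splitP => k; rewrite ?ord1 //= => -[] /ord_inj ->.
clearbody S.
(* Deleting row 0 removes the only entry that depends on [e], so these cofactors may be taken at
   [e = 0]. *)
have cofE e j : cofactor (A - diag_mx (S e)) 0 j = cofactor (A - diag_mx (S 0)) 0 j.
  congr (_ * \det _); apply/matrixP => i k.
  by rewrite !mxE; case: eqP => // <-; rewrite !Sl.
have cof0 : cofactor (A - diag_mx (S 0)) 0 0 = \det (row' 0 (col' 0 A) - diag_mx s).
  rewrite /cofactor mul1r; congr (\det _); apply/matrixP => i k.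
  by rewrite !mxE (inj_eq lift_inj) Sl.
have detE e : \det (A - diag_mx (S e)) = \det (A - diag_mx (S 0))
                - e * \det (row' 0 (col' 0 A) - diag_mx s).
  rewrite !(expand_det_row _ 0) !big_ord_recl /= !cofE cof0 !mxE !S0 !eqxx !mulr1n.
  rewrite subr0 mulrBl addrAC; congr (_ + _ - _); apply: eq_bigr => j _.
  by rewrite !cofE !mxE !(negPf (neq_lift _ _)) !mulr0n.
case: (eqVneq (\det (A - diag_mx (S 1))) 0) => [d1|]; last first.
  by exists (S 1) => //; apply: S2; rewrite expr1n.
exists (S (-1)); first by apply: S2; rewrite sqrrN expr1n.
move: d1; rewrite (detE 1) (detE (-1)) mul1r => /eqP; rewrite subr_eq0 => /eqP ->.
by rewrite mulN1r opprK -mulr2n -mulr_natl mulf_neq0.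
Qed.

(* The matrix of left multiplication by the quaternion a + bi + cj + dk. *)
Definition four_square_mx {R : comPzRingType} (a b c d : R) : 'M[R]_4 :=
  \matrix_(i, j) nth 0 (nth [::] [:: [:: a; - b; - c; - d]; [:: b; a; - d; c];
    [:: c; d; a; - b]; [:: d; - c; b; a]] i) j.

Lemma four_square_mxP (R : comPzRingType) (a b c d : R) :
  (four_square_mx a b c d)^T *m four_square_mx a b c d =
  (a ^+ 2 + b ^+ 2 + c ^+ 2 + d ^+ 2)%:M.
Proof.
apply/matrixP => i j; rewrite !mxE !big_ord_recl big_ord0 !mxE /=.
by case: i => [[|[|[|[|]]]] ?] //; case: j => [[|[|[|[|]]]] ?] //=; ring.
Qed.

Lemma exists_scaled_orthogonal_mx (R : comPzRingType) (a b c d : R) (k : nat) :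
  exists H : 'M[R]_(4 * k),
    H^T *m H = (a ^+ 2 + b ^+ 2 + c ^+ 2 + d ^+ 2)%:M.
Proof.
elim: k => [|k [H HH]]; first by exists 0; apply/matrixP; case.
rewrite mulnS; exists (block_mx (four_square_mx a b c d) 0 0 H).
rewrite tr_block_mx !trmx0 mulmx_block four_square_mxP HH.
by rewrite !mulmx0 !mul0mx !addr0 !add0r -scalar_mx_block.
Qed.


(* The Bruck-Ryser substitution: in coordinates y with y^T y = n x^T x, the signs s
   make the v equations (N x)_i = s_i y_i solvable with last coordinate y_v = 1. *)
Lemma design_mx_square_eq (F : fieldType) (v k : nat) (N : 'M[F]_v) (a b c d : F)
    (n := a ^+ 2 + b ^+ 2 + c ^+ 2 + d ^+ 2) :
  2 != 0 :> F -> n != 0 -> (v + 1 = 4 * k)%N ->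
  N^T *m N = n%:M + const_mx 1 -> exists x w : F, n * x ^+ 2 = 1 + w ^+ 2.
Proof.
move=> two_neq0 n_neq0 v4 NN.
have [H HH] : exists H : 'M[F]_(v + 1), H^T *m H = n%:M.
  by rewrite v4; apply: exists_scaled_orthogonal_mx.
pose K := n^-1 *: H^T.
have HK : H *m K = 1%:M.
  by apply: mulmx1C; rewrite -scalemxAl HH scale_scalar_mx mulVf.
(* [N] is padded with a zero column for the extra coordinate that brings the dimension to [4 * k];
   [M] is this map in the coordinates [y = H x]. *)
pose M := row_mx N 0 *m K.
have [s s2 det_neq0] := exists_sign_det_neq0 (lsubmx M) two_neq0.
(* This solves [M y = diag_mx s *m y'] once the last coordinate of [y] is set to 1. *)
pose y' := - (invmx (lsubmx M - diag_mx s) *m rsubmx M).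
pose y := col_mx y' 1.
have My : M *m y = diag_mx s *m y'.
  rewrite -[M]hsubmxK mul_row_col mulmx1; apply/eqP.
  rewrite -subr_eq0 addrAC -mulmxBl /y' mulmxN mulmxA mulmxV ?unitmxE ?unitfE //.
  by rewrite mul1mx addNr.
pose x := K *m y; pose x1 := usubmx x; pose x2 := dsubmx x.
have Nx : N *m x1 = diag_mx s *m y'.
  rewrite -My /M -mulmxA -/x -[x in RHS]vsubmxK mul_row_col mul0mx addr0 //.
have Hx : H *m x = y by rewrite mulmxA HK mul1mx.
have normy : y'^T *m y' + 1 = n *: (x1^T *m x1 + x2^T *m x2).
  transitivity (y^T *m y); first by rewrite tr_col_mx mul_row_col trmx1 mulmx1.
  rewrite -Hx trmx_mul -mulmxA (mulmxA H^T) HH mul_scalar_mx -scalemxAr.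
  by rewrite -[x]vsubmxK tr_col_mx mul_row_col.
pose u : 'rV[F]_v := const_mx 1.
(* The signs square to 1, so [y'] and [N *m x1] have equal norms; the all-ones part of [N^T *m N]
   contributes the square of the coordinate sum of [x1]. *)
have normN : y'^T *m y' = n *: (x1^T *m x1) + (u *m x1)^T *m (u *m x1).
  have -> : y'^T *m y' = (N *m x1)^T *m (N *m x1).
    rewrite Nx trmx_mul tr_diag_mx -mulmxA (mulmxA (diag_mx s)) mulmx_diag.
    rewrite (_ : \row_j _ = const_mx 1) ?diag_const_mx ?mul1mx //.
    by apply/rowP => j; rewrite !mxE -expr2 s2.
  rewrite !trmx_mul -!mulmxA (mulmxA N^T) NN mulmxDl mulmxDr mul_scalar_mx.
  rewrite -scalemxAr; congr (_ + _ *m _); rewrite mulmxA; congr (_ *m _).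
  by apply/matrixP => i j; rewrite !mxE big_ord_recl big_ord0 !mxE mulr1 addr0.
exists (x2 0 0), ((u *m x1) 0 0).
have sqE (z : 'M[F]_1) : z^T *m z = (z 0 0 ^+ 2)%:M.
  by rewrite {1 2}[z]mx11_scalar tr_scalar_mx -scalar_mxM.
(* The terms in [x1] cancel between the two norm identities. *)
move: normy; rewrite normN !sqE scalerDr -addrA => /addrI/matrixP/(_ 0 0).
by rewrite !mxE eqxx !mulr1n addrC => ->.
Qed.

Lemma projective_plane_square_eq (P L : finType) (I : L -> P -> bool)
    (a b c d k : nat) (n := (a ^ 2 + b ^ 2 + c ^ 2 + d ^ 2)%N) :
  #|L| = #|P| -> (#|P| + 1 = 4 * k)%N -> (0 < n)%N ->
  (forall p q, #|[set l | I l p && I l q]| = (p == q) * n + 1)%N ->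
  exists x w : rat, n%:R * x ^+ 2 = 1 + w ^+ 2.
Proof.
move=> cardL P4 n_gt0 cardI.
pose N := \matrix_(i < #|P|, j < #|P|)
  (I (enum_val (cast_ord (esym cardL) i)) (enum_val j))%:R : 'M[rat]_#|P|.
have nE : n%:R = a%:R ^+ 2 + b%:R ^+ 2 + c%:R ^+ 2 + d%:R ^+ 2 :> rat.
  by rewrite !natrD !natrX.
have NN : N^T *m N = n%:R%:M + const_mx 1.
  apply/matrixP => i j; rewrite !mxE.
  rewrite -(inj_eq enum_val_inj) -mulrnA.
  transitivity (#|[set l | I l (enum_val i) && I l (enum_val j)]|%:R : rat).
    rewrite -sum1dep_card natr_sum [RHS]big_mkcond /=.
    rewrite [RHS](reindex (fun i => enum_val (cast_ord (esym cardL) i))) /=.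
      by apply: eq_bigr => l _; rewrite !mxE -natrM mulnb; case: (_ && _).
    exists (fun l => cast_ord cardL (enum_rank l)) => l _.
      by rewrite enum_valK cast_ordKV.
    by rewrite cast_ordK enum_rankK.
  by rewrite cardI natrD mulnC.
rewrite nE in NN *.
by apply: (design_mx_square_eq _ _ P4 NN); rewrite // -nE pnatr_eq0 -lt0n.
Qed.

End LinearAlgebra.

(** * From a permutation code to the family of functions *)

(** For distinct codewords, two agreements and at least [d] disagreements would require
    [d + 2 <= n]. *)
Lemma code_agree (n d : nat) (Gamma : {set 'S_n}) (phi psi : 'S_n) (x y : 'I_n) :
  perm_code d Gamma -> n <= d.+1 -> phi \in Gamma -> psi \in Gamma ->
  x != y -> phi x = psi x -> phi y = psi y -> phi = psi.
Proof.
move=> /perm_codeP code nd phiG psiG xy ex ey.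
case: (eqVneq phi psi) => [//|/eqP neq].
have := code _ _ phiG psiG neq; rewrite dHE => le.
have : #|[set z | phi z != psi z]| + #|[set x; y]| <= n.
  rewrite -cardsUI (_ : _ :&: _ = set0) ?cards0 ?addn0.
    by rewrite (leq_trans (max_card _)) ?card_ord.
  apply/setP => z; rewrite !inE; apply/negP => /andP[nz /orP[]/eqP E].
    by rewrite E ex eqxx in nz.
  by rewrite E ey eqxx in nz.
rewrite cards2 xy addn2 => lt; have := leq_trans lt nd.
by rewrite ltnS ltnNge le.
Qed.

(** The constants serve as horizontal lines, raising [n * n.-1] graphs to [n ^ 2]. *)
Definition code_functions (n : nat) (Gamma : {set 'S_n}) : {set {ffun 'I_n -> 'I_n}} :=
  [set [ffun x => (phi : 'S_n) x] | phi in Gamma] :|: [set [ffun=> a] | a : 'I_n].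

Lemma card_code_functions (n : nat) (Gamma : {set 'S_n}) :
  1 < n -> n * n.-1 <= #|Gamma| -> #|'I_n| ^ 2 <= #|code_functions Gamma|.
Proof.
case: n Gamma => [|[|n]] // Gamma _ le.
rewrite cardsU (_ : _ :&: _ = set0) ?cards0 ?subn0; last first.
  apply/setP => f; rewrite !inE; apply/negP => /andP[].
  case/imsetP => phi _ -> /imsetP[a _] /ffunP E.
  have := E ord0; have := E ord_max; rewrite !ffunE => <- /perm_inj.
  by [].
rewrite !card_in_imset ?card_ord ?cardsT ?card_ord.
- by rewrite -mulnn mulnS addnC leq_add2r.
- by move=> a b _ _ /ffunP/(_ ord0); rewrite !ffunE.
- by move=> f g _ _ /ffunP E; apply/permP => x; have := E x; rewrite !ffunE.
Qed.

(** A permutation meets a constant only once by injectivity, and constants that meet are equal. *)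
Lemma code_functions_agree (n d : nat) (Gamma : {set 'S_n}) f g (x y : 'I_n) :
  perm_code d Gamma -> n <= d.+1 ->
  f \in code_functions Gamma -> g \in code_functions Gamma ->
  x != y -> f x = g x -> f y = g y -> f = g.
Proof.
move=> code nd fG gG xy.
case/setUP: fG => /imsetP[phi phiG ->]; case/setUP: gG => /imsetP[psi psiG ->];
  rewrite !ffunE => ex ey.
- by rewrite (code_agree code nd phiG psiG xy ex ey).
- by move: xy; rewrite (@perm_inj _ phi x y) ?eqxx // ex.
- by move: xy; rewrite (@perm_inj _ psi x y) ?eqxx // -ex.
- by rewrite ex.
Qed.

Theorem mainTheorem4 : M 6 5 < 30.
Proof.
apply/ltn_MP => Gamma code; rewrite ltnNge; apply/negP => card_Gamma.
pose G := code_functions Gamma.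
have oe : (ord0 : 'I_6) != ord_max by [].
have G_card : #|'I_6| ^ 2 <= #|G| by apply: card_code_functions.
have G_eq f g x y : f \in G -> g \in G ->
    x != y -> f x = g x -> f y = g y -> f = g.
  exact: (code_functions_agree code isT).
(* The order is 6 = 4 + 1 + 1 + 0, and the 36 + 7 = 43 points give 43 + 1 = 4 * 11. *)
have := @projective_plane_square_eq _ _ (@incident _ G ord0 ord_max) 2 1 1 0 11.
case.
- exact: (card_projective_lines G_card G_eq oe).
- by rewrite card_sum card_prod card_option !card_ord.
- by [].
- by move=> p q; rewrite card_incident2 // card_ord.
by move=> x [w] /eqP; apply/negP; apply: rat_neq_6square.
Qed.
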